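(* Let $G$ be a commutative cancellative semigroup of cardinality $\kappa$, and let $\theta\le\kappa$. If $\circledast(\kappa,\theta)$ holds, then $G\nrightarrow[\kappa]^{\mathrm{FS}_2}_\theta$ holds.
   Context: $\circledast(\kappa,\theta)$ asserts there is $d:[\kappa]^{<\omega}\rightarrow\theta$ (where $[\kappa]^{<\omega}$ is the set of finite subsets of $\kappa$) such that for every $\mathcal X\subseteq[\kappa]^{<\omega}$ with $|\mathcal X|=\kappa$ and every $\delta<\theta$ there are distinct $x,y\in\mathcal X$ with $d(z)=\delta$ for every $z$ satisfying $x\triangle y\subseteq z\subseteq x\cup y$. For a commutative semigroup $G$, $\mathrm{FS}_n(X):=\{x_1+\cdots+x_n\mid x_1,\ldots,x_n\in X \text{ pairwise distinct}\}$, and $G\nrightarrow[\lambda]^{\mathrm{FS}_n}_\theta$ means there is a colouring $c:G\rightarrow\theta$ such that $c[\mathrm{FS}_n(X)]=\theta$ for every $X\subseteq G$ with $|X|=\lambda$. *)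

(* Defs.v *)
From HB Require Import structures.
From mathcomp Require Import all_boot all_order all_algebra finmap.
From mathcomp Require Import boolp classical_sets functions cardinality.

Set Implicit Arguments.
Unset Strict Implicit.
Unset Printing Implicit Defensive.

Import GRing.Theory.

Local Open Scope classical_set_scope.
Local Open Scope card_scope.

(* A cardinal is represented by a type of that cardinality: the notions below
   do not use the ordering of its elements.  Thus |X| = kappa reads
   X #= [set: K], and theta <= kappa reads [set: Theta] #<= [set: K].  The
   choiceType structure required by {fset K} exists classically on any type. *)

Definition fsetsymd (K : choiceType) (x y : {fset K}) : {fset K} :=
  ((x `\` y) `|` (y `\` x))%fset.

Definition circledast (K : choiceType) (Theta : Type) : Prop :=
  exists d : {fset K} -> Theta,
    forall X : set {fset K}, X #= [set: K] ->
    forall delta : Theta,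
    exists x y : {fset K},
      [/\ X x, X y, x <> y &
          forall z : {fset K},
            (fsetsymd x y `<=` z)%fset -> (z `<=` x `|` y)%fset ->
            d z = delta].

(* A semigroup has no neutral element to start the sum from, so the sum of
   x :: s is folded from x; FS 0 X is empty. *)
Definition FS (G : addSemigroupType) (n : nat) (X : set G) : set G :=
  [set g | exists (x : G) (s : seq G),
    [/\ size (x :: s) = n, uniq (x :: s), [set` x :: s] `<=` X &
        g = foldl +%R x s]].

(* G -/-> [lambda]^(FS_n)_theta, with lambda = |L| and theta = |Theta| *)
Definition not_arrow_FS (G : addSemigroupType) (L : Type) (n : nat)
    (Theta : Type) : Prop :=
  exists c : G -> Theta,
    forall X : set G, X #= [set: L] -> c @` FS n X = [set: Theta].

(* Main.v *)
(* Embed G into an abelian group and build a map s from it to the finite subsets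
   of K that behaves like the support in a direct sum of countable groups:
   s x (+) s y <= s (x + y) <= s x `|` s y, where (+) is the symmetric
   difference, and s is countable-to-one.  If K is uncountable, then s maps sets
   of size |K| onto sets of size |K|, so the colouring c := d \o s works.

   No divisible hull is needed to build s.  Suppose that s is defined on a
   subgroup A and that g is not in A, and let a generate the multiples of g that
   lie in A; then an element x = y + n g outside A, with y in A, receives the
   support {g} `|` s a `|` s y, and Zorn's lemma does the rest.

   If K is countable, there are |K| many finite sets whose pairwise unions avoid
   a given colour as soon as there are two colours, so circledast leaves at most
   one colour and the conclusion is trivial. *)

Require Import Defs.
From HB Require Import structures.
From mathcomp Require Import all_boot all_order all_algebra finmap.
From mathcomp Require Import boolp classical_sets functions cardinality.

Set Implicit Arguments.
Unset Strict Implicit.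
Unset Printing Implicit Defensive.

Local Open Scope classical_set_scope.
Local Open Scope card_scope.

(** * Cardinalities and countable-to-one maps *)

Lemma card_le_inj T U (A : set T) (B : set U) (f : T -> U) :
  (forall x, A x -> B (f x)) ->
  (forall x y, A x -> A y -> f x = f y -> x = y) -> A #<= B.
Proof.
move=> fAB finj; apply: card_le_trans (subset_card_le (_ : f @` A `<=` B)).
  have : f @` A #= A.
    by apply: inj_card_eq => x y /set_mem Ax /set_mem Ay; apply: finj.
  by rewrite card_eq_sym card_eq_le => /andP[].
by move=> _ [x Ax <-]; apply: fAB.
Qed.

Lemma card_setT_le_inj T U (B : set U) :
  [set: T] #<= B -> exists2 f : T -> U, (forall x, B (f x)) & injective f.
Proof.
move=> /card_leP[f]; pose g x := val (f (SigSub (mem_set (I : [set: T] x)))).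
exists g => [x|x y]; first exact/set_mem/valP.
by move=> /val_inj/(inj (mem_set I) (mem_set I))/(congr1 val).
Qed.

(** The last clause covers both injectivity of each sequence (the case [u = v]) and disjointness of
    the ranges. *)
Definition disjoint_sequences T (Y : set T) (M : set (nat -> T)) :=
  (forall u n, M u -> Y (u n)) /\
  (forall u v n m, M u -> M v -> u n = v m -> u = v /\ n = m).

(** By Zorn: an infinite remainder would contain an injective sequence, which could be added to a
    maximal [M]. *)
Lemma maximal_disjoint_sequences T (Y : set T) :
  exists2 M, disjoint_sequences Y M &
    finite_set (Y `\` [set u n | u in M & n in [set: nat]]).
Proof.
have [|M [[MY Minj] Mmax]] := @Zorn_bigcup _ (disjoint_sequences Y).
  move=> F FP Ftot; split=> [u n [M FM Mu]|u v n m [M FM Mu] [N FN Nv]].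
    by have [MY _] := FP _ FM; apply: MY.
  have [MN|NM] := Ftot _ _ FM FN.
    by have [_] := FP _ FN; apply=> //; apply: MN.
  by have [_] := FP _ FM; apply=> //; apply: NM.
exists M => //; apply: contrapT => /infiniteP/card_setT_le_inj[v vR vinj].
apply: (Mmax (M `|` [set v])); last first.
  split=> [u n [Mu|->]|u w n m [Mu|->] [Mw|->]].
  - exact: MY.
  - by have [] := vR n.
  - exact: Minj.
  - by move=> e; have [_ []] := vR m; exists u => //; exists n.
  - by move=> e; have [_ []] := vR n; exists w => //; exists m.
  - by move=> /vinj.
split; first by move=> u; left.
move=> /(_ v (or_intror erefl)) Mv.
by have [_ []] := vR 0; exists v => //; exists 0.
Qed.

(** Each point of [Y] gets a sequence of [M] and a label from a countable set; the label paired with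
    [n] is coded as a position in the same sequence. *)
Lemma infinite_card_setXnat T (Y : set T) :
  infinite_set Y -> Y `*` [set: nat] #<= Y.
Proof.
move=> Yinf; have [M [MY Minj]] := maximal_disjoint_sequences Y.
set R := _ `\` _ => Rfin.
have [u0 Mu0] : M !=set0.
  apply/set0P/eqP => M0; apply: Yinf; apply: sub_finite_set Rfin => y Yy.
  by split=> // -[u]; rewrite M0.
have /countable_injP[r rinj] := finite_set_countable Rfin.
(* With flag [false], [y] sits at the given position of its sequence; with flag [true], [y] has the
   given rank in the finite remainder and the sequence is arbitrary. *)
pose Q y (p : (nat -> T) * (bool * nat)) := M p.1 /\
  if p.2.1 then R y /\ r y = p.2.2 else y = p.1 p.2.2.
have Qex y : exists p, Y y -> Q y p.
  have [Yy|nYy] := pselect (Y y); last by exists (u0, (true, 0)) => /nYy.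
  have [[u Mu [n _ /esym uny]]|nR] :=
      pselect ([set u n | u in M & n in [set: nat]] y).
    by exists (u, (false, n)); split=> //=.
  by exists (u0, (true, r y)); split.
have [h hQ] := choice Qex.
have hinj y y' : Y y -> Y y' -> h y = h y' -> y = y'.
  move=> /hQ; case: (h y) => u [[] n] [/= Mu Hy] /hQ Hy' e; move: Hy'; rewrite -e.
    move=> [_ /= [Ry' ry']]; case: Hy => Ry ry.
    by apply: rinj; rewrite ?inE // ry ry'.
  by move=> [_ /= ->].
apply: (@card_le_inj _ _ _ _
    (fun p : T * nat => (h p.1).1 (choice.pickle ((h p.1).2, p.2)))).
  by move=> [y n] [/= /hQ[Mh _] _]; apply: MY.
move=> [y n] [y' n'] [/= Yy _] [/= Yy' _].
move=> /(Minj _ _ _ _ (hQ _ Yy).1 (hQ _ Yy').1)[e1 /(pcan_inj choice.pickleK)[e2 ->]].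
by congr pair; apply: hinj => //; rewrite [LHS]surjective_pairing e1 e2 -surjective_pairing.
Qed.

(** Numbering each fibre embeds [X] into the product of its image with [nat]. The image is infinite,
    as [X] would otherwise be countable, so it absorbs the factor [nat]. *)
Lemma card_image_countable_fibers T U (f : T -> U) (X : set T) :
  ~ countable X -> (forall u, countable (X `&` f @^-1` [set u])) ->
  f @` X #= X.
Proof.
move=> Xunc fib; apply: Cantor_Bernstein (card_image_le _ _) _.
have /choice[r rinj] u : exists r : T -> nat,
    {in X `&` f @^-1` [set u] &, injective r}.
  exact/countable_injP/fib.
have XfX : X #<= (f @` X) `*` [set: nat].
  apply: (@card_le_inj _ _ _ _ (fun x => (f x, r (f x) x))).
    by move=> x Xx; split=> //; exists x.
  move=> x y Xx Xy [fxy rxy]; apply: (rinj (f x)).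
  - by rewrite inE.
  - by rewrite inE fxy.
  - by rewrite rxy fxy.
apply: (card_le_trans XfX); apply: infinite_card_setXnat => fXfin.
by apply: Xunc; apply: sub_countable XfX _; apply: countableX => //; apply: finite_set_countable.
Qed.

(** * The group of differences of a cancellative semigroup *)

Section GroupOfDifferences.
Import Algebra.
Local Open Scope quotient_scope.
Local Open Scope ring_scope.

Variable G : addSemigroupType.
Hypothesis addG_inj : right_injective (+%R : G -> G -> G).
Variable g0 : G.

Let diff_rel (p q : G * G) := p.1 + q.2 == q.1 + p.2.

Let diff_refl : reflexive diff_rel.
Proof. by move=> p; rewrite /diff_rel. Qed.

Let diff_sym : symmetric diff_rel.
Proof. by move=> p q; rewrite /diff_rel eq_sym. Qed.

Let diff_trans : transitive diff_rel.
Proof.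
move=> q p r /eqP pq /eqP qr; apply/eqP/(addG_inj (y := q.2)).
by rewrite addrCA addrA pq addrAC qr -addrA addrCA.
Qed.

Canonical diff_equiv := EquivRel diff_rel diff_refl diff_sym diff_trans.
Definition diff_group := {eq_quot diff_rel}.
HB.instance Definition _ : EqQuotient _ diff_rel diff_group :=
  EqQuotient.on diff_group.
HB.instance Definition _ := Choice.on diff_group.

Let pi (p : G * G) : diff_group := \pi p.
Let add (u v : diff_group) := pi ((repr u).1 + (repr v).1, (repr u).2 + (repr v).2).
Let opp (u : diff_group) := pi ((repr u).2, (repr u).1).

Let pi_eq p q : pi p = pi q <-> p.1 + q.2 = q.1 + p.2.
Proof. by split=> [/eqmodP/eqP|e] //; apply/eqmodP/eqP. Qed.

Let repr_pi p : (repr (pi p)).1 + p.2 = p.1 + (repr (pi p)).2.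
Proof. by apply/pi_eq; rewrite /pi reprK. Qed.

Let pi_add p q : add (pi p) (pi q) = pi (p.1 + q.1, p.2 + q.2).
Proof. by apply/pi_eq; rewrite /= addrACA !repr_pi addrACA. Qed.

Let pi_opp p : opp (pi p) = pi (p.2, p.1).
Proof. by apply/pi_eq; rewrite /= addrC -repr_pi addrC. Qed.

Let piP u : exists p, u = pi p.
Proof. by exists (repr u); rewrite /pi reprK. Qed.

Let addA : associative add.
Proof.
move=> u v w; have [p ->] := piP u; have [q ->] := piP v; have [r ->] := piP w.
by rewrite !pi_add /= !addrA.
Qed.

Let addC : commutative add.
Proof.
move=> u v; have [p ->] := piP u; have [q ->] := piP v.
by rewrite !pi_add /= addrC [X in (_, X)]addrC.
Qed.

Let add0 : left_id (pi (g0, g0)) add.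
Proof.
move=> u; have [p ->] := piP u; rewrite pi_add; apply/pi_eq => /=.
by rewrite addrAC addrC.
Qed.

Let addN : left_inverse (pi (g0, g0)) opp add.
Proof.
move=> u; have [p ->] := piP u; rewrite pi_opp pi_add; apply/pi_eq => /=.
by rewrite addrC [X in g0 + X]addrC.
Qed.

HB.instance Definition _ := GRing.isZmodule.Build diff_group addA addC add0 addN.

Lemma semigroup_embeds_in_zmod :
  exists (V : zmodType) (i : G -> V), injective i /\ {morph i : x y / x + y}.
Proof.
(* Since [G] may have no zero, [x] is represented by the formal difference of [x + g0] and [g0]. *)
exists diff_group; exists (fun x => pi (x + g0, g0)); split=> [x y /pi_eq/= | x y].
  by rewrite -!addrA [x + _]addrC [y + _]addrC => /addG_inj.
rewrite [RHS]pi_add; apply/pi_eq => /=.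
by rewrite [x + g0 + _]addrACA !addrA.
Qed.

End GroupOfDifferences.

(** * Finite supports in an abelian group *)

Section Supports.
Import GRing.Theory Num.Theory Order.TTheory.
Local Open Scope ring_scope.
Variables (V : zmodType) (I : choiceType) (iota : I -> V).

(* [s] plays the role of the support in a direct sum of countable groups: for
   each index [i] the elements [x] of [A] with [i \notin s x] form a subgroup. *)
Definition support_on (A : set V) (s : V -> {fset I}) : Prop :=
  [/\ A 0, (forall x y, A x -> A y -> A (x - y)),
      (forall x i, A x -> i \in s x -> A (iota i)),
      (forall x y, A x -> A y -> (s (x - y) `<=` s x `|` s y)%fset) &
      (forall F : {fset I}, countable [set x | A x /\ (s x `<=` F)%fset])].

Lemma subgroupN (A : set V) x :
  A 0 -> (forall x y, A x -> A y -> A (x - y)) -> A x -> A (- x).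
Proof. by move=> A0 AB Ax; rewrite -sub0r; apply: AB. Qed.

Lemma subgroupD (A : set V) x y :
  A 0 -> (forall x y, A x -> A y -> A (x - y)) -> A x -> A y -> A (x + y).
Proof.
by move=> A0 AB Ax Ay; rewrite -[y]opprK; apply: (AB) => //; apply: subgroupN.
Qed.

Lemma support0 A s x : support_on A s -> A x -> (s 0 `<=` s x)%fset.
Proof.
move=> [_ _ _ sB _] Ax.
by rewrite -(subrr x) (fsubset_trans (sB _ _ Ax Ax)) // fsetUid.
Qed.

Lemma supportN A s x : support_on A s -> A x -> (s (- x) `<=` s x)%fset.
Proof.
move=> sup Ax; have [A0 _ _ sB _] := sup.
rewrite -sub0r (fsubset_trans (sB _ _ A0 Ax)) // fsubUset fsubset_refl andbT.
exact: support0 sup Ax.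
Qed.

Lemma supportD A s x y : support_on A s -> A x -> A y ->
  (s (x + y)%R `<=` s x `|` s y)%fset.
Proof.
move=> sup Ax Ay; have [A0 AB _ sB _] := sup.
rewrite -[y in x + y]opprK.
apply: fsubset_trans (sB _ _ Ax (subgroupN A0 AB Ay)) _.
by apply: fsetUSS => //; apply: supportN sup Ay.
Qed.

Lemma supportD_ge A s x y : support_on A s -> A x -> A y ->
  (s x `<=` s (x + y)%R `|` s y)%fset.
Proof.
move=> [A0 AB _ sB _] Ax Ay; rewrite -[in s x](addrK y x).
by apply: sB => //; apply: subgroupD.
Qed.

(** By [x = (x + y) - y], an index of [x] that is not one of [y] must occur in [s (x + y)]; likewise
    with [x] and [y] exchanged. *)
Lemma supportD_symd A s x y : support_on A s -> A x -> A y ->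
  (fsetsymd (s x) (s y) `<=` s (x + y)%R)%fset.
Proof.
move=> sup Ax Ay; rewrite /fsetsymd fsubUset !fsubDset fsetUC.
rewrite (supportD_ge sup Ax Ay) /= fsetUC addrC.
exact: supportD_ge sup Ay Ax.
Qed.

(* The last clause keeps the fibres countable along chains of extensions: an
   element added after stage [A] never has its support indexed within [A]. *)
Definition support_ext (p q : set V * (V -> {fset I})) : Prop :=
  [/\ p.1 `<=` q.1, (forall x, p.1 x -> q.2 x = p.2 x) &
      (forall x, q.1 x -> ~ p.1 x -> exists2 i, i \in q.2 x & ~ p.1 (iota i))].

Lemma support_ext_refl p : support_ext p p.
Proof. by split. Qed.

Lemma support_ext_trans p q r :
  support_ext p q -> support_ext q r -> support_ext p r.
Proof.
move=> [pq1 pq2 pq3] [qr1 qr2 qr3]; split=> [x /pq1/qr1 //|x px|x rx npx].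
  by rewrite qr2 ?pq2 //; apply: pq1.
have [qx|/(qr3 _ rx)[i ix nqi]] := pselect (q.1 x).
  by rewrite qr2 //; apply: pq3.
by exists i => // /pq1.
Qed.

Lemma support_on0 : support_on [set 0] (fun=> fset0).
Proof.
split=> //= [x y -> ->|F]; first by rewrite subr0.
apply: sub_countable (countable1 (0 : V)); apply: subset_card_le.
by move=> x [].
Qed.

(** The union works. Countability for [F] is inherited from a single member of the chain, one
    containing every [iota i] with [i] in [F] that lies in the union. *)
Lemma support_on_chain (C : set (set V * (V -> {fset I}))) :
  C !=set0 -> (forall p, C p -> support_on p.1 p.2) ->
  total_on C support_ext ->
  exists2 q, support_on q.1 q.2 & forall p, C p -> support_ext p q.
Proof.
move=> [p0 Cp0] Csup Ctot.
pose A := \bigcup_(p in C) p.1.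
have /choice[s sP] x : exists t, forall p, C p -> p.1 x -> t = p.2 x.
  have [[p Cp px]|nAx] := pselect (A x); last first.
    by exists fset0 => p Cp px; case: nAx; exists p.
  exists (p.2 x) => q Cq qx.
  by have [[_ -> //]|[_ -> //]] := Ctot _ _ Cp Cq.
have join2 p q : C p -> C q -> exists2 r, C r & p.1 `<=` r.1 /\ q.1 `<=` r.1.
  move=> Cp Cq; have [[pq _ _]|[qp _ _]] := Ctot _ _ Cp Cq.
    by exists q => //; split.
  by exists p => //; split.
have A2 x y : A x -> A y -> exists2 r, C r & r.1 x /\ r.1 y.
  move=> [p Cp px] [q Cq qy]; have [r Cr [pr qr]] := join2 _ _ Cp Cq.
  by exists r => //; split; [apply: pr|apply: qr].
have extA p : C p -> support_ext p (A, s).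
  move=> Cp; split=> /= [x px|x px|x [q Cq qx] npx]; first by exists p.
    exact: sP.
  rewrite (sP x q) //; have [[_ _ pq]|[qp _ _]] := Ctot _ _ Cp Cq.
    exact: pq.
  by case: npx; apply: qp.
have finA (F : seq I) :
    exists2 r, C r & forall i, i \in F -> A (iota i) -> r.1 (iota i).
  elim: F => [|j F [r Cr rF]]; first by exists p0.
  have [[q Cq qj]|nAj] := pselect (A (iota j)).
    have [t Ct [rt qt]] := join2 _ _ Cr Cq; exists t => // i.
    rewrite inE => /orP[/eqP -> _|iF Ai]; first exact: qt.
    by apply: rt; apply: rF.
  by exists r => // i; rewrite inE => /orP[/eqP -> //|]; apply: rF.
exists (A, s) => //; split=> /=.
- by exists p0 => //; have [] := Csup _ Cp0.
- move=> x y Ax Ay; have [r Cr [rx ry]] := A2 _ _ Ax Ay.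
  by exists r => //; have [_ + _ _ _] := Csup _ Cr; apply.
- move=> x i [r Cr rx]; rewrite (sP x r) // => ix.
  by exists r => //; have [_ _ + _ _] := Csup _ Cr; apply; eassumption.
- move=> x y Ax Ay; have [r Cr [rx ry]] := A2 _ _ Ax Ay.
  have [_ rB _ rs _] := Csup _ Cr.
  by rewrite (sP _ r) ?(sP x r) ?(sP y r) //; [apply: rs|apply: rB].
- move=> F; have [r Cr rF] := finA F.
  have [_ _ _ _ /(_ F)] := Csup _ Cr; apply: sub_countable.
  apply: subset_card_le => x [Ax sxF].
  have rx : r.1 x.
    (* If [x] entered after stage [r], some [i] in its support would have [iota i] outside [r.1];
       but [i] is in [F] and [iota i] in [A], against the choice of [r]. *)
    apply: contrapT => nrx; have [_ _ /(_ x Ax nrx)[i ix]] := extA _ Cr.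
    apply; apply: rF; first exact: (fsubsetP sxF).
    have [p Cp px] := Ax; exists p => //; move: ix; rewrite /= (sP x p) //.
    by have [_ _ + _ _] := Csup _ Cp; apply.
  by split=> //; rewrite -(sP x r).
Qed.

(* If some positive multiple of [g] lies in [A], take the least one; otherwise
   take [a = 0]. *)
Lemma multiples_in_subgroup (A : set V) (g : V) :
  A 0 -> (forall x y, A x -> A y -> A (x - y)) ->
  exists2 a, A a & forall q : int, A (g *~ q) -> exists t : int, g *~ q = a *~ t.
Proof.
move=> A0 AB.
have AN x : A x -> A (- x) := @subgroupN A x A0 AB.
have AMn x n : A x -> A (x *+ n).
  move=> Ax; elim: n => [|n IH]; first by rewrite mulr0n.
  by rewrite mulrS -[_ *+ n]opprK; apply: AB => //; apply: AN.
have AMz x (n : int) : A x -> A (x *~ n).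
  by move=> Ax; case: n => n; [apply: AMn|apply: AN; apply: AMn].
have [mex|nom] := pselect (exists m, `[< A (g *+ m.+1) >]).
  case: (ex_minnP mex) => m /asboolP Am mmin; exists (g *+ m.+1) => // q Aq.
  exists (q %/ m.+1)%Z.
  have gq : g *~ q = (g *+ m.+1) *~ (q %/ m.+1)%Z + g *~ (q %% m.+1)%Z.
    by rewrite -[g *+ m.+1]/(g *~ m.+1) -mulrzA mulrC -mulrzDr -divz_eq.
  have Ar : A (g *~ (q %% m.+1)%Z).
    rewrite -[X in A X](addKr ((g *+ m.+1) *~ (q %/ m.+1)%Z)) -gq addrC.
    by apply: AB => //; apply: AMz.
  suff r0 : (q %% m.+1)%Z = 0 by rewrite gq r0 mulr0z addr0.
  have := modz_ge0 q (isT : m.+1%:Z != 0); have := ltz_pmod q (isT : 0 < m.+1%:Z).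
  move: Ar; case: (q %% m.+1)%Z => [[|r]|] //= Ar + _.
  rewrite ltz_nat ltnS => rm; have := mmin r (introT (asboolP _) Ar).
  by rewrite leqNgt rm.
exists 0 => // q Aq; exists 0; rewrite mulr0z.
suff [n qn Ann] : exists2 n, `|q|%N = n & A (g *+ n).
  case: n qn Ann => [/eqP|n] qn Ann; last by case: nom; exists n; apply/asboolP.
  by move: qn; rewrite absz_eq0 => /eqP ->; rewrite mulr0z.
exists `|q|%N => //; case: (intP q) Aq => [|n|n] //.
by rewrite mulrNz => /AN; rewrite opprK abszN.
Qed.

(** The chosen coefficient of [g] need not be additive. The error is a multiple of [g] lying in [A],
    hence a multiple of [a]; putting [s a] into every new support absorbs it. *)
Lemma support_on_extend (A : set V) (s : V -> {fset I}) (j : I) :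
  support_on A s -> ~ A (iota j) ->
  exists2 q, support_on q.1 q.2 & support_ext (A, s) q /\ q.1 (iota j).
Proof.
move=> sup nAg; have [A0 AB sA sB sfin] := sup; set g := iota j in nAg *.
have [a Aa aP] := multiples_in_subgroup g A0 AB.
have AN x : A x -> A (- x) := @subgroupN A x A0 AB.
have AD x y : A x -> A y -> A (x + y) := @subgroupD A x y A0 AB.
have sN x : A x -> (s (- x) `<=` s x)%fset := @supportN A s x sup.
have sMn n : A (a *+ n) /\ (s (a *+ n) `<=` s a)%fset.
  elim: n => [|n [An sn]]; first by rewrite mulr0n; split=> //; apply: support0 sup Aa.
  rewrite mulrS; split; first exact: AD.
  by rewrite (fsubset_trans (supportD sup Aa An)) // fsubUset fsubset_refl.
have sg (q : int) : A (g *~ q) -> (s (g *~ q) `<=` s a)%fset.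
  move=> /aP[[n|n] ->]; first by have [] := sMn n.
  by have [An sn] := sMn n.+1; rewrite (fsubset_trans (sN _ An)).
have subACA (x y u v : V) : (x - u) - (y - v) = (x - y) - (u - v).
  by rewrite opprD addrACA -opprD.
pose A' := [set x | exists n : int, A (x - g *~ n)].
(* Requiring [n x = 0] on [A] makes the remainder [r] the identity there. *)
have /choice[n nP] x : exists n : int,
    (A' x -> A (x - g *~ n)) /\ (A x -> n = 0).
  have [Ax|nAx] := pselect (A x).
    by exists 0; rewrite mulr0z subr0.
  have [[n An]|nA'x] := pselect (A' x); first by exists n.
  by exists 0.
pose r x := x - g *~ n x.
have rA x : A' x -> A (r x) by case: (nP x).
have rid x : A x -> r x = x.
  by move=> Ax; rewrite /r (nP x).2 // mulr0z subr0.
have AA' x : A x -> A' x by move=> Ax; exists 0; rewrite mulr0z subr0.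
have A'B x y : A' x -> A' y -> A' (x - y).
  move=> [k Ak] [l Al]; exists (k - l).
  by rewrite mulrzBr -subACA; apply: AB.
have rB x y : A' x -> A' y ->
    (s (r (x - y)) `<=` s (r x) `|` s (r y) `|` s a)%fset.
  move=> Ax Ay; have Axy := A'B _ _ Ax Ay.
  (* [q] measures how far [n] is from respecting subtraction. *)
  pose q := n x - n y - n (x - y).
  have rq : r (x - y) = (r x - r y) - - (g *~ q).
    by rewrite opprK /r /q !mulrzBr subACA addrA subrK.
  have Aq : A (g *~ q).
    rewrite (_ : g *~ q = r (x - y) - (r x - r y)).
      by apply: (AB); [apply: (rA)|apply: (AB); apply: rA].
    by rewrite rq opprK addrC addKr.
  rewrite rq (fsubset_trans (sB _ _ (AB _ _ (rA _ Ax) (rA _ Ay)) (AN _ Aq))) //.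
  apply: fsetUSS; first by apply: sB; apply: rA.
  exact: fsubset_trans (sN _ Aq) (sg _ Aq).
pose s' x := if `[< A x >] then s x else (j |` s a `|` s (r x))%fset.
have s'A x : A x -> s' x = s x by move=> Ax; rewrite /s' asboolT.
have s'nA x : ~ A x -> s' x = (j |` s a `|` s (r x))%fset.
  by move=> nAx; rewrite /s' asboolF.
have A'g : A' g by exists 1; rewrite mulr1z subrr.
have sub_s' x : (s (r x) `<=` s' x)%fset.
  have [Ax|nAx] := pselect (A x); first by rewrite s'A // rid.
  by rewrite s'nA // fsubsetUr.
exists (A', s'); last first.
  split=> //; split=> //= x A'x nAx; exists j => //.
  by rewrite s'nA // !inE eqxx.
split=> /=.
- exact: AA'.
- exact: A'B.
- move=> x i A'x; have [Ax|nAx] := pselect (A x).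
    by rewrite s'A // => /sA Ai; apply/AA'/Ai.
  rewrite s'nA // !inE => /orP[/orP[/eqP -> //|]|] ix; apply: AA'.
    exact: sA ix.
  by apply: sA ix; apply: rA.
- move=> x y A'x A'y.
  have [[Ax Ay]|nA] := pselect (A x /\ A y).
    by rewrite !s'A //; [apply: sB|apply: AB].
  (* Unless both points lie in [A], one of them already carries [j] and [s a]. *)
  have jaU : (j |` s a `<=` s' x `|` s' y)%fset.
    have [Ax|nAx] := pselect (A x); last first.
      by apply: fsubset_trans (fsubsetUl _ _); rewrite s'nA // fsubsetUl.
    have nAy : ~ A y by move=> Ay; apply: nA.
    by apply: fsubset_trans (fsubsetUr _ _); rewrite s'nA // fsubsetUl.
  have rU : (s (r (x - y)) `<=` s' x `|` s' y)%fset.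
    apply: fsubset_trans (rB _ _ A'x A'y) _.
    rewrite !fsubUset (fsubset_trans (sub_s' x)) ?fsubsetUl //.
    rewrite (fsubset_trans (sub_s' y)) ?fsubsetUr //=.
    by apply: fsubset_trans jaU; apply: fsubsetUr.
  have [Axy|nAxy] := pselect (A (x - y)).
    by rewrite s'A // -[x - y]rid.
  by rewrite s'nA // fsubUset jaU.
(* [x] is recovered from the integer [n x] and from [r x], which ranges over a countable subset of
   [A]. *)
- move=> F; apply: sub_countable (countableX (sfin F) (countableP [set: int])).
  apply: (@card_le_inj _ _ _ _ (fun x => (r x, n x))).
    move=> x [A'x s'F]; split=> //=; split; first exact: rA.
    exact: fsubset_trans (sub_s' x) s'F.
  by move=> x y _ _ [rxy nxy]; rewrite -[x](subrK (g *~ n x)) -/(r x) rxy nxy subrK.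
Qed.

(** Zorn for a preorder: [support_ext] leaves values outside the subgroup free. Any extension of a
    maximal pair has its subgroup inside [A], so no [iota i] can be missing. *)
Lemma support_exists :
  exists2 q, support_on q.1 q.2 & forall i, q.1 (iota i).
Proof.
pose T := {p : set V * (V -> {fset I}) | support_on p.1 p.2}.
pose R (p q : T) := `[< support_ext (sval p) (sval q) >].
have [||C Ctot|[[A s] As] maxA] := @ZL_preorder T (exist _ (_, _) support_on0) R.
- by move=> p; apply/asboolP/support_ext_refl.
- move=> q p r /asboolP qp /asboolP pr; apply/asboolP.
  exact: support_ext_trans qp pr.
- have [[c Cc]|C0] := pselect (C !=set0); last first.
    exists (exist _ (_, _) support_on0) => p Cp; case: C0; by exists p.
  have [|||q qsup qub] := @support_on_chain [set sval p | p in C].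
  + by exists (sval c); exists c.
  + by move=> _ [p _ <-]; apply: (svalP p).
  + move=> p' q' [p Cp <-] [q Cq <-].
    by have [/asboolP|/asboolP] := Ctot _ _ Cp Cq; [left|right].
  by exists (exist _ q qsup) => p Cp; apply/asboolP/qub; exists p.
exists (A, s) => //= i; apply: contrapT => nAi.
have [q qsup [Aq qi]] := support_on_extend As nAi.
by have /asboolP[/= /(_ _ qi)] := maxA (exist _ q qsup) (introT (asboolP _) Aq).
Qed.

End Supports.

(** * Consequences of [circledast], and the countable case *)

Lemma circledast_two_points (K : choiceType) (Theta : Type) (delta : Theta) :
  circledast K Theta -> exists i j : K, i <> j.
Proof.
move=> [d dP].
have [|_ [_ [[i _ <-] [j _ <-] ij _]]] := dP (range (@fset1 K)) _ delta.
  by apply: inj_card_eq => i j _ _; apply: fset1_inj.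
by exists i, j => e; apply: ij; rewrite e.
Qed.

(* The sets tested are the complements of points if K is finite, and otherwise
   the members of an infinite chain of finite sets that [d] does not colour by
   [delta]. *)
Lemma circledast_countable (K : choiceType) (Theta : Type) :
  countable [set: K] -> circledast K Theta ->
  forall delta delta' : Theta, delta = delta'.
Proof.
move=> Kcount [d dP].
have dU (X : set {fset K}) delta : X #= [set: K] ->
    exists x y, [/\ X x, X y, x <> y & d (x `|` y)%fset = delta].
  move=> XK; have [x [y [Xx Xy xy xyd]]] := dP X XK delta; exists x, y; split=> //.
  by apply: xyd => //; rewrite /fsetsymd fsetUSS // fsubsetDl.
have [/finite_fsetP[S KS]|Kinf] := pselect (finite_set [set: K]).
  have inS i : i \in S by have : [set: K] i by []; rewrite KS.
  (* Complements of two different points have union [S], so [S] would receive every colour. *)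
  suff dS delta : d S = delta by move=> delta delta'; rewrite -(dS delta) -(dS delta').
  have [|_ [_ [[i _ <-] [j _ <-] ij <-]]] := dU (range (fun i => S `\ i)%fset) delta.
    apply: inj_card_eq => i j _ _ /fsetP/(_ i); rewrite !inE eqxx inS andbT.
    by case: eqP.
  congr (d _); apply/fsetP => k; rewrite !inE inS !andbT.
  by case: eqP => //= ->; case: eqP => // e; case: ij; rewrite e.
have [f _ finj] := card_setT_le_inj ((infiniteP _).1 Kinf).
(* The union of two initial segments of [f] is the longer one, so every subfamily is closed under
   unions. *)
pose x n := [fset k in map f (iota 0 n)]%fset.
have fx m n : (f m \in x n) = (m < n)%N.
  by rewrite !inE mem_map // mem_iota.
have xinj : injective x.
  move=> m n xmn; apply/eqP; rewrite eqn_leq.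
  have lemn a b : x a = x b -> (a <= b)%N.
    by move=> xab; rewrite leqNgt -fx xab fx ltnn.
  by rewrite !lemn.
have xS m n : (m <= n)%N -> (x m `<=` x n)%fset.
  move=> mn; apply/fsubsetP => k; rewrite inE => /mapP[a]; rewrite mem_iota.
  by move=> /andP[_ am] ->; rewrite fx (leq_trans am).
have xU m n : (x m `|` x n)%fset = x (maxn m n).
  case: leqP => [mn|/ltnW nm]; first exact/fsetUidPr/xS.
  exact/fsetUidPl/xS.
move=> delta delta'; apply: contrapT => ne.
(* An infinite [N e] would index a family of full size whose unions all miss the colour [e]; for two
   different colours, two finite sets would cover [nat]. *)
pose N e := [set n | d (x n) <> e].
have Nfin e : finite_set (N e).
  apply: contrapT => Ninf.
  have [|_ [_ [[m Nm <-] [n Nn <-] _]]] := dU (x @` N e) e.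
    apply: card_eq_trans (inj_card_eq _) _; first by move=> a b _ _; apply: xinj.
    apply: card_eq_trans (eq_card_nat (countableP _) Ninf) _.
    by apply: card_esym; apply: eq_card_nat.
  by rewrite xU; case: leqP.
apply: infinite_nat; apply: (sub_finite_set (B := N delta `|` N delta')).
  move=> n _; have [e|] := pselect (d (x n) = delta); last by left.
  by right; rewrite /N /= e.
by rewrite finite_setU.
Qed.

Theorem theorem4p7 (K : choiceType) (Theta : Type) (G : addSemigroupType)
    (G_cancellative : right_injective (+%R : G -> G -> G))
    (card_G : [set: G] #= [set: K])
    (Theta_le_K : [set: Theta] #<= [set: K]) :
  circledast K Theta -> not_arrow_FS G K 2 Theta.
Proof.
move=> circ; have [d dP] := circ.
have FS2 (X : set G) x y : X x -> X y -> x <> y -> FS 2 X (x + y)%R.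
  move=> Xx Xy /eqP xy; exists x, [:: y]; split=> //=; first by rewrite inE xy.
  by move=> z; rewrite /= !inE => /orP[]/eqP->.
have [Kcount|Kunc] := pselect (countable [set: K]).
  (* There is only one colour, so it suffices that [X] has two distinct points to add. *)
  exists (fun=> d fset0) => X; rewrite card_eq_sym card_eq_le => /andP[KX _].
  have [f Xf finj] := card_setT_le_inj KX.
  apply/seteqP; split=> // delta _.
  have [i [j ij]] := circledast_two_points delta circ.
  exists (f i + f j)%R; last exact: (circledast_countable Kcount circ).
  by apply: FS2 => // /finj.
have [g0 _] : [set: G] !=set0.
  apply/set0P/eqP => G0; apply: Kunc.
  by rewrite -(eq_countable card_G) G0.
have [V [emb [emb_inj embD]]] := semigroup_embeds_in_zmod G_cancellative g0.
have [h _ hinj] : exists2 h : G -> K, (forall x, [set: K] (h x)) & injective h.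
  by apply: card_setT_le_inj; move: card_G; rewrite card_eq_le => /andP[].
(* Points of [K] index the image of [G], so that supports are finite subsets of [K]; off the range
   of [h], [emb g0] is a default. *)
have /choice[iota iotaP] k : exists v, forall x, h x = k -> v = emb x.
  have [[x <-]|nk] := pselect (exists x, h x = k).
    by exists (emb x) => y /hinj ->.
  by exists (emb g0) => x hx; case: nk; exists x.
have [[A s] /= sup Aiota] := support_exists iota.
have Aemb x : A (emb x) by rewrite -(iotaP (h x) x).
pose S x := s (emb x).
have [_ _ _ _ sfin] := sup.
exists (fun x => d (S x)) => X XK.
apply/seteqP; split=> // delta _.
have [|_ [_ [[x Xx <-] [y Xy <-] xy xyd]]] := dP (S @` X) _ delta.
  apply: (card_eq_trans _ XK); apply: card_image_countable_fibers => [|u].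
    by rewrite (eq_countable XK).
  (* The fibre over [u] consists of elements with support inside [u]. *)
  apply: sub_countable (sfin u); apply: (card_le_inj (f := emb)).
    by move=> x [_ /= <-]; split.
  by move=> x y _ _ /emb_inj.
exists (x + y)%R; first by apply: FS2 => // e; apply: xy; rewrite e.
(* The support of [x + y] is itself an admissible [z]. *)
by apply: xyd; rewrite /S embD; [apply: supportD_symd sup _ _|apply: supportD sup _ _].
Qed.
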